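(* For every hpgcl-program $c$ and all expectations $X,Y\in\mathbb{E}_{\le1}$ with $\mathrm{Mod}(c)\cap\mathrm{Vars}(Y)=\emptyset$: $\mathrm{wlp}[c](X)\star Y\preceq\mathrm{wlp}[c](X\star Y)$.
   Context: Programs of hpgcl: $c::=\mathtt{skip}\mid x:=e\mid c;c\mid\mathtt{if}\,(b)\,\{c\}\,\mathtt{else}\,\{c\}\mid\mathtt{while}\,(b)\,\{c\}\mid\{c\}\,[p]\,\{c\}\mid x:=\mathtt{new}(e_1,\dots,e_n)\mid\langle e\rangle:=e'\mid x:=\langle e\rangle\mid\mathtt{free}(e)$, with $x$ a variable, $e,e',e_i$ arithmetic expressions over variables, $b$ a Boolean guard over variables, $p\in[0,1]\cap\mathbb{Q}$. $\mathrm{Mod}(c)$ is the set of variables $x$ occurring on the left of $x:=e$, $x:=\mathtt{new}(\dots)$ or $x:=\langle e\rangle$ in $c$. States are pairs $(s,h)$ of a stack $s:\mathrm{Vars}\to\mathbb{Z}$ and a heap $h:N\to\mathbb{Z}$, $N=\mathrm{dom}(h)\subseteq\mathbb{N}_{>0}$ finite; $\Sigma$ is the set of states; $s(e)$ is the value of $e$; heaps are disjoint ($\perp$) if their domains are and $h_1\star h_2$ is their union. $\mathbb{E}_{\le1}$ is the set of functions $\Sigma\to[0,1]$ ordered pointwise by $\preceq$ (a complete lattice); arithmetic, $\sup$, $\inf$ pointwise; $[\varphi]$ is the indicator of predicate $\varphi$. $\mathrm{Vars}(Y)$ is the set of $x$ such that $Y(s[x\mapsto v],h)\neq Y(s[x\mapsto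 v'],h)$ for some $(s,h)$ and $v,v'\in\mathbb{Z}$. $(X\star Y)(s,h)=\max\{X(s,h_1)\cdot Y(s,h_2)\mid h=h_1\star h_2\}$; $([\varphi]\mathbin{-\!\!\star}X)(s,h)=\inf\{X(s,h\star h')\mid h'\perp h,\ (s,h')\models\varphi\}$. $[e\mapsto e_1,\dots,e_n](s,h)=1$ iff $\mathrm{dom}(h)=\{s(e),\dots,s(e)+n-1\}$ and $h(s(e)+i-1)=s(e_i)$ for all $i$; $[e\mapsto -](s,h)=1$ iff $\mathrm{dom}(h)=\{s(e)\}$. $X[x/e]=\lambda(s,h).X(s[x\mapsto s(e)],h)$. The weakest liberal preexpectation $\mathrm{wlp}[c]:\mathbb{E}_{\le1}\to\mathbb{E}_{\le1}$: $\mathrm{wlp}[\mathtt{skip}](X)=X$; $\mathrm{wlp}[x:=e](X)=X[x/e]$; $\mathrm{wlp}[c_1;c_2](X)=\mathrm{wlp}[c_1](\mathrm{wlp}[c_2](X))$; $\mathrm{wlp}[\mathtt{if}\,(b)\,\{c_1\}\,\mathtt{else}\,\{c_2\}](X)=[b]\cdot\mathrm{wlp}[c_1](X)+[\neg b]\cdot\mathrm{wlp}[c_2](X)$; $\mathrm{wlp}[\mathtt{while}\,(b)\,\{c'\}](X)=\mathrm{gfp}\,Y.\,[\neg b]\cdot X+[b]\cdot\mathrm{wlp}[c'](Y)$ (greatest fixed point); $\mathrm{wlp}[\{c_1\}[p]\{c_2\}](X)=p\cdot\mathrm{wlp}[c_1](X)+(1-p)\cdot\mathrm{wlp}[c_2](X)$;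 $\mathrm{wlp}[x:=\mathtt{new}(e_1,\dots,e_n)](X)(s,h)=\inf\{([v\mapsto e_1,\dots,e_n]\mathbin{-\!\!\star}X[x/v])(s,h)\mid v\in\mathbb{N}_{>0},\ v,\dots,v+n-1\notin\mathrm{dom}(h)\}$; $\mathrm{wlp}[x:=\langle e\rangle](X)=\sup_{v\in\mathbb{Z}}[e\mapsto v]\star([e\mapsto v]\mathbin{-\!\!\star}X[x/v])$; $\mathrm{wlp}[\langle e\rangle:=e'](X)=[e\mapsto -]\star([e\mapsto e']\mathbin{-\!\!\star}X)$; $\mathrm{wlp}[\mathtt{free}(e)](X)=[e\mapsto -]\star X$. *)

(* Defs.v *)
From HB Require Import structures.
From mathcomp Require Import all_boot all_order all_algebra.
From mathcomp Require Import finmap.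
From mathcomp Require Import mathcomp_extra boolp classical_sets functions.
From mathcomp Require Import cardinality reals numfun.

Set Implicit Arguments.
Unset Strict Implicit.
Unset Printing Implicit Defensive.

Import Order.TTheory GRing.Theory Num.Theory.
Local Open Scope classical_set_scope.
Local Open Scope ring_scope.

Section Syntax.
Variable V : eqType.

(* No particular set of arithmetic operators, comparisons or Boolean
   connectives is singled out: an operator node carries its interpretation. *)
Inductive expr : Type :=
| Cst of int
| Var of V
| Op1 of (int -> int) & expr
| Op2 of (int -> int -> int) & expr & expr.

Inductive bexpr : Type :=
| BCst of bool
| BCmp of (int -> int -> bool) & expr & expr
| BNot of bexpr
| BOp of (bool -> bool -> bool) & bexpr & bexpr.

Inductive cmd : Type :=
| Skip
| Assign of V & expr
| Seq of cmd & cmd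
| If of bexpr & cmd & cmd
| While of bexpr & cmd
| PChoice of cmd & {p : rat | 0 <= p <= 1} & cmd
| New of V & seq expr
| Store of expr & expr (* Store e e' is <e> := e' *)
| Lookup of V & expr
| Free of expr.

Fixpoint Mod (c : cmd) : set V :=
  match c with
  | Assign x _ | New x _ | Lookup x _ => [set x]
  | Seq c1 c2 | If _ c1 c2 | PChoice c1 _ c2 => Mod c1 `|` Mod c2
  | While _ c' => Mod c'
  | Skip | Store _ _ | Free _ => set0
  end.

Definition stack := V -> int.

Definition upd (s : stack) (x : V) (v : int) : stack :=
  fun y => if y == x then v else s y.

Fixpoint eval (e : expr) (s : stack) : int :=
  match e with
  | Cst z => z
  | Var x => s x
  | Op1 f e1 => f (eval e1 s)
  | Op2 f e1 e2 => f (eval e1 s) (eval e2 s)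
  end.

Fixpoint beval (b : bexpr) (s : stack) : bool :=
  match b with
  | BCst t => t
  | BCmp r e1 e2 => r (eval e1 s) (eval e2 s)
  | BNot b1 => ~~ beval b1 s
  | BOp f b1 b2 => f (beval b1 s) (beval b2 s)
  end.

End Syntax.

Arguments Cst {V}.
Arguments BCst {V}.
Arguments Skip {V}.

(* Addresses are the positive integers, so that values can be used as
   addresses without a cast. *)
Record heap : Type := Heap {
  cells : {fmap int -> int};
  heap_pos : forall l : int, l \in domf cells -> 0 < l }.

Definition dom (h : heap) : {fset int} := domf (cells h).

Definition hdisj (h1 h2 : heap) : bool := [disjoint dom h1 & dom h2]%fset.

Fact hunion_pos (h1 h2 : heap) (l : int) :
  l \in domf (catf (cells h1) (cells h2)) -> 0 < l.
Proof. by rewrite mem_catf => /orP[]; apply: heap_pos. Qed.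

(* Meaningful for disjoint heaps only (otherwise h2 overrides h1). *)
Definition hunion (h1 h2 : heap) : heap := Heap (@hunion_pos h1 h2).

Lemma dom_hunion (h1 h2 : heap) :
  dom (hunion h1 h2) = (dom h1 `|` dom h2)%fset.
Proof. exact: domf_cat. Qed.

Section Semantics.
Variables (R : realType) (V : eqType).

Definition state : Type := (stack V * heap)%type.

Implicit Types (X Y Z : state -> R) (phi : set state) (e : expr V) (x : V).

Definition E1 : set (state -> R) :=
  [set X | forall sg, 0 <= X sg <= 1].

Definition ele X Y : Prop := forall sg, X sg <= Y sg.

Definition Vars Y : set V :=
  [set x | exists (s : stack V) (h : heap) (v v' : int),
     Y (upd s x v, h) <> Y (upd s x v', h)].

Definition subst X x e : state -> R :=
  fun sg => X (upd sg.1 x (eval e sg.1), sg.2).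

(* Infimum in the complete lattice [0, 1], where the infimum of the empty set
   is 1 (whereas [inf set0 = 0]). Suprema below are all of nonempty subsets of
   [0, 1], hence agree with [sup]. *)
Definition inf01 (A : set R) : R := inf (1 |` A).

(* The maximum is attained: see [star_max]. *)
Definition star X Y : state -> R := fun sg =>
  sup [set r | exists h1 h2 : heap,
    [/\ hdisj h1 h2, sg.2 = hunion h1 h2 & r = X (sg.1, h1) * Y (sg.1, h2)]].

Definition wand phi X : state -> R := fun sg =>
  inf01 [set r | exists h' : heap,
    [/\ hdisj h' sg.2, phi (sg.1, h') & r = X (sg.1, hunion sg.2 h')]].

Definition points_to e (es : seq (expr V)) : set state :=
  [set sg |
    let a := eval e sg.1 in
    (forall l : int, l \in dom sg.2 <-> a <= l < a + (size es)%:Z) /\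
    (forall i : nat, (i < size es)%N ->
       (cells sg.2).[? a + i%:Z]%fmap = Some (eval (nth (Cst 0) es i) sg.1))].

Definition allocated e : set state :=
  [set sg | dom sg.2 = [fset eval e sg.1]%fset].

Definition guard (b : bexpr V) : set state := [set sg | beval b sg.1].

(* Knaster-Tarski; see [wlp_while_gfp] for the defining property. *)
Definition gfp (F : (state -> R) -> (state -> R)) : state -> R :=
  fun sg => sup [set Y sg | Y in [set Y | E1 Y /\ ele Y (F Y)]].

Definition is_gfp (F : (state -> R) -> (state -> R)) Z : Prop :=
  [/\ E1 Z, F Z = Z & forall Y, E1 Y -> F Y = Y -> ele Y Z].

Fixpoint wlp (c : cmd V) (X : state -> R) {struct c} : state -> R :=
  match c with
  | Skip => X
  | Assign x e => subst X x e
  | Seq c1 c2 => wlp c1 (wlp c2 X)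
  | If b c1 c2 => fun sg =>
      \1_(guard b) sg * wlp c1 X sg + \1_(~` guard b) sg * wlp c2 X sg
  | While b c' => gfp (fun Y sg =>
      \1_(~` guard b) sg * X sg + \1_(guard b) sg * wlp c' Y sg)
  | PChoice c1 p c2 => fun sg =>
      ratr (sval p) * wlp c1 X sg + (1 - ratr (sval p)) * wlp c2 X sg
  | New x es => fun sg =>
      inf01 [set wand (points_to (Cst v) es) (subst X x (Cst v)) sg |
             v in [set v : int | 0 < v /\
               forall i : nat, (i < size es)%N -> v + i%:Z \notin dom sg.2]]
  | Lookup x e => fun sg =>
      sup [set star \1_(points_to e [:: Cst v])
                    (wand (points_to e [:: Cst v]) (subst X x (Cst v))) sg |
           v in [set: int]]
  | Store e e' => star \1_(allocated e) (wand (points_to e [:: e']) X)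
  | Free e => star \1_(allocated e) X
  end.

Section Facts.
Implicit Types (sg : state) (h : heap) (A : set R).

Lemma heap_eq h1 h2 : cells h1 = cells h2 -> h1 = h2.
Proof.
case: h1 h2 => [m1 p1] [m2 p2] /= e; subst m2.
by rewrite (Prop_irrelevance p1 p2).
Qed.

Fact hrestr_pos h (B : {fset int}) (l : int) :
  l \in domf (restrictf (cells h) B) -> 0 < l.
Proof. by rewrite mem_restrictf => /andP[_]; apply: heap_pos. Qed.

Definition hrestr h (B : {fset int}) : heap := Heap (@hrestr_pos h B).

Lemma star_max X Y sg : exists h1 h2 : heap,
  [/\ hdisj h1 h2, sg.2 = hunion h1 h2,
      star X Y sg = X (sg.1, h1) * Y (sg.1, h2) &
      forall h1' h2', hdisj h1' h2' -> sg.2 = hunion h1' h2' ->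
        X (sg.1, h1') * Y (sg.1, h2') <= X (sg.1, h1) * Y (sg.1, h2)].
Proof.
case: sg => s h /=.
pose T : finType := fpowerset (dom h).
pose g (B : T) := hrestr h (val B).
pose g' (B : T) := hrestr h (dom h `\` val B)%fset.
have h0 : fset0 \in fpowerset (dom h) by rewrite fpowersetE fsub0set.
pose F (B : T) : R := X (s, g B) * Y (s, g' B).
have [B _ Bmax] := @Order.TotalTheory.arg_maxP _ _ T [` h0]%fset xpredT F isT.
have dj : hdisj (g B) (g' B).
  rewrite /hdisj /dom /=; apply/eqP/fsetP => l.
  rewrite in_fsetI !mem_restrictf in_fsetD in_fset0.
  by case: (l \in val B); rewrite ?andbF.
have hE : h = hunion (g B) (g' B).
  apply: heap_eq; apply/fmapP => l.
  rewrite /= fnd_cat !fnd_restrict mem_restrictf in_fsetD /dom.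
  by case: fndP => lh; case: (l \in val B);
    rewrite ?andbF ?lh // ?not_fnd // if_same.
have ub h1 h2 : hdisj h1 h2 -> h = hunion h1 h2 ->
    X (s, h1) * Y (s, h2) <= X (s, g B) * Y (s, g' B).
  move=> d12 e.
  have h1p : dom h1 \in fpowerset (dom h).
    by rewrite fpowersetE e dom_hunion fsubsetUl.
  suff -> : X (s, h1) * Y (s, h2) = F [` h1p]%fset by apply: Bmax.
  rewrite /F; congr (X (s, _) * Y (s, _)); apply: heap_eq; apply/fmapP => l.
    rewrite /= fnd_restrict e /= fnd_cat.
    have /fdisjointP/(_ l) := d12; rewrite /dom.
    case: (boolP (l \in domf (cells h1))) => [l1 /(_ isT)/negPf -> //|l1 _].
    by rewrite not_fnd.
  rewrite /= fnd_restrict e dom_hunion in_fsetD in_fsetU /= fnd_cat.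
  have /fdisjointP/(_ l) := d12; rewrite /dom.
  case: (boolP (l \in domf (cells h1))) => [l1 /(_ isT) l2 /=|l1 _ /=].
    by rewrite not_fnd.
  by case: (boolP (l \in domf (cells h2))) => [//|l2]; rewrite not_fnd.
exists (g B), (g' B); split => //.
apply/le_anti/andP; split.
  by apply: ge_sup; [exists (X (s, g B) * Y (s, g' B)); exists (g B), (g' B)|
    move=> r [h1 [h2 [d12 e ->]]]; apply: ub].
apply: ub_le_sup; last by exists (g B), (g' B).
by exists (X (s, g B) * Y (s, g' B)) => r [h1 [h2 [d12 e ->]]]; apply: ub.
Qed.

Lemma inf01_lb A r : (forall t, A t -> 0 <= t) -> A r -> inf01 A <= r.
Proof.
by move=> A0 Ar; apply: ge_inf; [exists 0 => t [->|/A0]//|right].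
Qed.

Lemma le_inf01 A r : r <= 1 -> (forall t, A t -> r <= t) -> r <= inf01 A.
Proof.
by move=> r1 rA; apply: lb_le_inf; [exists 1; left|move=> t [->|/rA]].
Qed.

Lemma inf01_itv A : (forall t, A t -> 0 <= t) -> 0 <= inf01 A <= 1.
Proof.
move=> A0; rewrite le_inf01 //=.
by apply: ge_inf; [exists 0 => t [->|/A0]//|left].
Qed.

Lemma indic_E1 (phi : set state) : E1 (\1_phi : state -> R).
Proof. by move=> sg; rewrite indicE; case: (sg \in phi); rewrite ?lexx ler01. Qed.

Lemma star_E1 X Y : E1 X -> E1 Y -> E1 (star X Y).
Proof.
move=> hX hY sg; have [h1 [h2 [_ _ -> _]]] := star_max X Y sg.
have /andP[x0 x1] := hX (sg.1, h1); have /andP[y0 y1] := hY (sg.1, h2).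
by rewrite mulr_ge0 //= mulr_ile1.
Qed.

Lemma star_mono X X' Y Y' : E1 X -> E1 Y -> ele X X' -> ele Y Y' ->
  ele (star X Y) (star X' Y').
Proof.
move=> hX hY lX lY sg; have [h1 [h2 [d e -> _]]] := star_max X Y sg.
have [k1 [k2 [_ _ -> ub]]] := star_max X' Y' sg.
apply: le_trans (ub _ _ d e).
have /andP[x0 _] := hX (sg.1, h1); have /andP[y0 _] := hY (sg.1, h2).
by apply: ler_pM.
Qed.

Lemma wand_E1 (phi : set state) X : E1 X -> E1 (wand phi X).
Proof.
move=> hX sg; apply: inf01_itv => t [h' [_ _ ->]].
by case/andP: (hX (sg.1, hunion sg.2 h')).
Qed.

Lemma wand_mono (phi : set state) X Y : E1 X -> ele X Y ->
  ele (wand phi X) (wand phi Y).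
Proof.
move=> hX lXY sg; have /andP[_ le1] := wand_E1 phi hX sg.
apply: le_inf01 => // t [h' [d p ->]]; apply: le_trans (lXY _).
apply: inf01_lb; last by exists h'.
by move=> r [k [_ _ ->]]; case/andP: (hX (sg.1, hunion sg.2 k)).
Qed.

Lemma subst_E1 X x e : E1 X -> E1 (subst X x e).
Proof. by move=> hX sg; apply: hX. Qed.

Lemma subst_mono X Y x e : ele X Y -> ele (subst X x e) (subst Y x e).
Proof. by move=> lXY sg; apply: lXY. Qed.

Lemma choice_E1 (a : R) X Y sg : E1 X -> E1 Y -> 0 <= a <= 1 ->
  0 <= a * X sg + (1 - a) * Y sg <= 1.
Proof.
move=> hX hY /andP[a0 a1].
have /andP[x0 x1] := hX sg; have /andP[y0 y1] := hY sg.
have b0 : 0 <= 1 - a by rewrite subr_ge0.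
rewrite addr_ge0 ?mulr_ge0 //= -[leRHS](subrK a 1) addrC.
by rewrite lerD // ler_piMr.
Qed.

Lemma choice_mono (a : R) X X' Y Y' sg : ele X X' -> ele Y Y' -> 0 <= a <= 1 ->
  a * X sg + (1 - a) * Y sg <= a * X' sg + (1 - a) * Y' sg.
Proof.
move=> lX lY /andP[a0 a1].
have b0 : 0 <= 1 - a by rewrite subr_ge0.
by rewrite lerD // ler_wpM2l.
Qed.

Lemma indic_guardC (phi : set state) sg : \1_(~` phi) sg = 1 - \1_phi sg :> R.
Proof.
by rewrite indicC indicE; case: (sg \in phi); rewrite /= ?subrr ?subr0.
Qed.

Lemma prob_itv (p : {p : rat | 0 <= p <= 1}) : 0 <= (ratr (sval p) : R) <= 1.
Proof.
by case: p => p /= /andP[p0 p1]; rewrite ler0q p0 /= -(ler_rat R) rmorph1 in p1 *.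
Qed.

Definition while_step (b : bexpr V) (W : (state -> R) -> state -> R) X Y :
    state -> R := fun sg =>
  \1_(~` guard b) sg * X sg + \1_(guard b) sg * W Y sg.

Lemma gfp_ub F Y : E1 Y -> ele Y (F Y) -> ele Y (gfp F).
Proof.
move=> hY lY sg; apply: ub_le_sup; last by exists Y.
by exists 1 => _ [Z [hZ _] <-]; case/andP: (hZ sg).
Qed.

Lemma gfp_le F sg r : 0 <= r -> (forall Y, E1 Y -> ele Y (F Y) -> Y sg <= r) ->
  (forall Y, E1 Y -> E1 (F Y)) -> gfp F sg <= r.
Proof.
move=> r0 ub FE; apply: ge_sup; last by move=> _ [Y [hY lY] <-]; apply: ub.
have E0 : E1 (fun=> 0) by move=> ?; rewrite lexx ler01.
by exists 0, (fun=> 0) => //; split=> // t; case/andP: (FE _ E0 t).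
Qed.

Lemma gfp_E1 F : (forall Y, E1 Y -> E1 (F Y)) -> E1 (gfp F).
Proof.
move=> FE sg; apply/andP; split.
  have E0 : E1 (fun=> 0) by move=> ?; rewrite lexx ler01.
  apply: (@gfp_ub F (fun=> 0)) => // t.
  by case/andP: (FE _ E0 t).
by apply: gfp_le => // Y hY _; case/andP: (hY sg).
Qed.

Lemma gfpP F : (forall Y, E1 Y -> E1 (F Y)) ->
  (forall Y Z, E1 Y -> E1 Z -> ele Y Z -> ele (F Y) (F Z)) -> is_gfp F (gfp F).
Proof.
move=> FE Fm; have GE := gfp_E1 FE.
have post : ele (gfp F) (F (gfp F)).
  move=> sg; apply: gfp_le => //; first by case/andP: (FE _ GE sg).
  move=> Y hY lY; apply: le_trans (lY sg) _.
  by apply: Fm => //; apply: gfp_ub.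
split=> //; last by move=> Y hY eY; apply: gfp_ub => //; rewrite eY => sg.
apply/funext => sg; apply/le_anti/andP; split=> //.
by apply: gfp_ub; [exact: FE|apply: Fm => //; exact: FE].
Qed.

Lemma while_step_E1 b W X Y : E1 X -> (forall Y, E1 Y -> E1 (W Y)) -> E1 Y ->
  E1 (while_step b W X Y).
Proof.
move=> hX WE hY sg; rewrite /while_step addrC indic_guardC.
by apply: choice_E1 => //; [exact: WE|exact: indic_E1].
Qed.

Lemma while_step_mono b W X X' Y Y' : ele X X' -> ele (W Y) (W Y') ->
  ele (while_step b W X Y) (while_step b W X' Y').
Proof.
move=> lX lY sg; rewrite /while_step !(addrC (\1_(~` _) _ * _)) indic_guardC.
by apply: choice_mono => //; exact: indic_E1.
Qed.

Lemma wlp_E1_mono (c : cmd V) : (forall X, E1 X -> E1 (wlp c X)) /\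
  (forall X Y, E1 X -> E1 Y -> ele X Y -> ele (wlp c X) (wlp c Y)).
Proof.
elim: c => [|x e|c1 [E1c m1] c2 [E2c m2]|b c1 [E1c m1] c2 [E2c m2]|b c [Ec mc]
  |c1 [E1c m1] p c2 [E2c m2]|x es|e e'|x e|e] /=; split=> //.
- by move=> X hX; exact: subst_E1.
- by move=> X Y hX hY; exact: subst_mono.
- by move=> X hX; exact/E1c/E2c.
- by move=> X Y hX hY l; apply: m1; [exact: E2c|exact: E2c|exact: m2].
- move=> X hX sg; rewrite indic_guardC.
  by apply: choice_E1; [exact: E1c|exact: E2c|exact: indic_E1].
- move=> X Y hX hY l sg; rewrite indic_guardC.
  by apply: choice_mono; [exact: m1|exact: m2|exact: indic_E1].
- by move=> X hX; apply: gfp_E1 => Y hY; exact: while_step_E1.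
- move=> X Y hX hY l.
  have [GE Gf _] := @gfpP (while_step b (wlp c) X)
    (fun Z hZ => while_step_E1 b hX Ec hZ)
    (fun Z Z' hZ hZ' lZ => while_step_mono b (fun=> lexx _) (mc _ _ hZ hZ' lZ)).
  apply: gfp_ub => //; rewrite -[X in ele X _]Gf.
  by apply: while_step_mono => // sg.
- move=> X hX sg.
  by apply: choice_E1; [exact: E1c|exact: E2c|exact: prob_itv].
- move=> X Y hX hY l sg.
  by apply: choice_mono; [exact: m1|exact: m2|exact: prob_itv].
- move=> X hX sg; apply: inf01_itv => _ [v _ <-].
  by case/andP: (wand_E1 (points_to (Cst v) es) (subst_E1 x (Cst v) hX) sg).
- move=> X Y hX hY l sg.
  have nn (B : set int) t : [set wand (points_to (Cst v) es)
      (subst X x (Cst v)) sg | v in B] t -> 0 <= t.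
    move=> [v _ <-].
    by case/andP: (wand_E1 (points_to (Cst v) es) (subst_E1 x (Cst v) hX) sg).
  apply: le_inf01.
    set A := (X in inf01 X); have /andP[] // : 0 <= inf01 A <= 1.
    by apply: inf01_itv => t /nn.
  move=> _ [v hv <-]; apply: (@le_trans _ _ (wand (points_to (Cst v) es)
      (subst X x (Cst v)) sg)).
    by apply: inf01_lb; [exact: nn|exists v].
  by apply: wand_mono; [exact: subst_E1|exact: subst_mono].
- by move=> X hX; apply: star_E1; [exact: indic_E1|exact: wand_E1].
- move=> X Y hX hY l; apply: star_mono.
  + exact: indic_E1.
  + exact: wand_E1.
  + by move=> sg.
  + exact: wand_mono.
- move=> X hX sg.
  have sE v := star_E1 (indic_E1 (points_to e [:: Cst v]))
    (wand_E1 (points_to e [:: Cst v]) (subst_E1 x (Cst v) hX)) sg.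
  apply/andP; split.
    have /andP[s0 _] := sE 0; apply: le_trans s0 _.
    by apply: ub_le_sup; [exists 1 => _ [v _ <-]; case/andP: (sE v)|exists 0].
  by apply: ge_sup; [eexists; exists 0|move=> _ [v _ <-]; case/andP: (sE v)].
- move=> X Y hX hY l sg.
  apply: ge_sup; first by eexists; exists 0.
  move=> _ [v _ <-]; apply: (@le_trans _ _ (star \1_(points_to e [:: Cst v])
    (wand (points_to e [:: Cst v]) (subst Y x (Cst v))) sg)).
    apply: star_mono; [exact: indic_E1|exact/wand_E1/subst_E1|by move=> ?|].
    by apply: wand_mono; [exact: subst_E1|exact: subst_mono].
  apply: ub_le_sup; last by exists v.
  exists 1 => _ [w _ <-].
  by case/andP: (star_E1 (indic_E1 (points_to e [:: Cst w]))
    (wand_E1 (points_to e [:: Cst w]) (subst_E1 x (Cst w) hY)) sg).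
- by move=> X hX; apply: star_E1 => //; exact: indic_E1.
- move=> X Y hX hY l; apply: star_mono => //; exact: indic_E1.
Qed.

Lemma wlp_E1 (c : cmd V) X : E1 X -> E1 (wlp c X).
Proof. by case: (wlp_E1_mono c) => + _; apply. Qed.

Lemma wlp_mono (c : cmd V) X Y : E1 X -> E1 Y -> ele X Y ->
  ele (wlp c X) (wlp c Y).
Proof. by case: (wlp_E1_mono c) => _; apply. Qed.

Lemma wlp_while_gfp (b : bexpr V) (c : cmd V) X : E1 X ->
  is_gfp (fun Y sg => \1_(~` guard b) sg * X sg + \1_(guard b) sg * wlp c Y sg)
         (wlp (While b c) X).
Proof.
move=> hX; apply: gfpP => [Y hY|Y Z hY hZ l].
  exact: (while_step_E1 b hX (@wlp_E1 c)).
by apply: (while_step_mono b (W := wlp c)) => //; exact: wlp_mono.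
Qed.

End Facts.

End Semantics.

(* Main.v *)
(** The rule is an induction on the program.  Conjoining a frame commutes, up
    to an inequality, with each construct of [wlp]: [star] is associative,
    subdistributes over convex combinations whose weights only depend on the
    stack and over suprema, and moves inside a magic wand because the heap
    added by the wand is disjoint from the frame.  For loops, the framed
    greatest fixed point is a post-fixed point of the characteristic function
    of the framed postexpectation, so coinduction applies. *)

Require Import Defs.
From mathcomp Require Import all_boot all_order all_algebra.
From mathcomp Require Import finmap boolp classical_sets reals numfun.

Set Implicit Arguments.
Unset Strict Implicit.
Unset Printing Implicit Defensive.

Import Order.TTheory GRing.Theory Num.Theory.

Local Open Scope classical_set_scope.
Local Open Scope ring_scope.

Lemma hdisjC h1 h2 : hdisj h1 h2 = hdisj h2 h1.
Proof. exact: fdisjoint_sym. Qed.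

Lemma hdisjUl h1 h2 h3 : hdisj (hunion h1 h2) h3 = hdisj h1 h3 && hdisj h2 h3.
Proof. by rewrite /hdisj dom_hunion fdisjointUX. Qed.

Lemma hdisjUr h1 h2 h3 : hdisj h1 (hunion h2 h3) = hdisj h1 h2 && hdisj h1 h3.
Proof. by rewrite /hdisj dom_hunion fdisjointXU. Qed.

Lemma hunionA h1 h2 h3 : hunion h1 (hunion h2 h3) = hunion (hunion h1 h2) h3.
Proof. by apply: heap_eq; rewrite /= catfA. Qed.

Lemma hunionC h1 h2 : hdisj h1 h2 -> hunion h1 h2 = hunion h2 h1.
Proof. by move=> d; apply: heap_eq; rewrite /= disjoint_catfC. Qed.

Lemma hunionAC h1 h2 h3 : hdisj h2 h3 ->
  hunion (hunion h1 h2) h3 = hunion (hunion h1 h3) h2.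
Proof. by move=> d; rewrite -!hunionA (hunionC d). Qed.

Section Frame.
Variables (R : realType) (V : eqType).
Implicit Types (X Y Z : state V -> R) (s : stack V) (h : heap) (x : V).

Lemma star_le X Y s h (r : R) :
  (forall h1 h2, hdisj h1 h2 -> h = hunion h1 h2 ->
     X (s, h1) * Y (s, h2) <= r) ->
  star X Y (s, h) <= r.
Proof.
by move=> ub; have [h1 [h2 [d e -> _]]] := star_max X Y (s, h); exact: ub.
Qed.

Lemma le_star X Y s h1 h2 : hdisj h1 h2 ->
  X (s, h1) * Y (s, h2) <= star X Y (s, hunion h1 h2).
Proof.
move=> d; have [k1 [k2 [_ _ -> ub]]] := star_max X Y (s, hunion h1 h2).
exact: ub.
Qed.

Lemma star_assoc_le X Y Z : E1 X ->
  ele (star (star X Y) Z) (star X (star Y Z)).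
Proof.
move=> hX [s h]; apply: star_le => h12 h3 d ->{h}.
have [h1 [h2 [/= d12 e -> _]]] := star_max X Y (s, h12).
move: d; rewrite {}e hdisjUl => /andP[d13 d23].
rewrite -hunionA -mulrA.
apply: le_trans (le_star X (star Y Z) s (h1 := h1) (h2 := hunion h2 h3) _).
  by rewrite ler_wpM2l ?le_star //; case/andP: (hX (s, h1)).
by rewrite hdisjUr d12.
Qed.

Lemma upd_notin_Vars Y x s h v : ~ Vars Y x -> Y (upd s x v, h) = Y (s, h).
Proof.
(* [Vars] only compares two updates of [x], so [s] is first written as its own update by [s x]. *)
move=> nx; have -> : Y (s, h) = Y (upd s x (s x), h).
  by congr (Y (_, h)); apply/funext => y; rewrite /upd; case: eqP => // ->.
by apply: contrapT => neq; apply: nx; exists s, h, v, (s x).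
Qed.

Lemma star_subst_le X Y x e : ~ Vars Y x ->
  ele (star (subst X x e) Y) (subst (star X Y) x e).
Proof.
move=> nx [s h]; apply: star_le => h1 h2 d ->.
by rewrite -(upd_notin_Vars s h2 (eval e s) nx); exact: (le_star X Y _ d).
Qed.

Lemma mul_itv01 (a b : R) : 0 <= a <= 1 -> 0 <= b <= 1 -> a * b <= 1.
Proof. by move=> /andP[? ?] /andP[? ?]; exact: mulr_ile1. Qed.

Lemma wand_lb (phi : set (state V)) X s h h' : E1 X -> hdisj h' h ->
  phi (s, h') -> wand phi X (s, h) <= X (s, hunion h h').
Proof.
move=> hX d p; apply: inf01_lb; last by exists h'.
by move=> _ [k [_ _ ->]]; case/andP: (hX (s, hunion h k)).
Qed.

(** A heap [h'] disjoint from [hunion h1 h2] is disjoint from both parts: it is therefore admissible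
    for the wand at [h1], and [h2] still frames [hunion h1 h']. *)
Lemma star_wand_le (phi : set (state V)) X Y : E1 X -> E1 Y ->
  ele (star (wand phi X) Y) (wand phi (star X Y)).
Proof.
move=> hX hY [s h]; apply: star_le => h1 h2 d ->{h}.
(* [inf01] also ranges over 1, its value on the empty set, so the product must be bounded by 1 as
   well. *)
apply: le_inf01; first by apply: mul_itv01; [exact: wand_E1|exact: hY].
move=> _ [h' [/= d' p ->]]; move: d'; rewrite hdisjUr => /andP[d1 d2].
rewrite (hunionAC h1) 1?hdisjC //.
apply: le_trans (le_star X Y s _); last by rewrite hdisjUl d.
by apply: ler_wpM2r; [case/andP: (hY (s, h2))|exact: wand_lb].
Qed.

(** Splitting the heap leaves the stack and hence the weights unchanged. Only an inequality results,
    since the two summands may have different optimal splits. *)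
Lemma star_choice_le (a : stack V -> R) X X' Y :
  (forall s, 0 <= a s <= 1) ->
  ele (star (fun sg => a sg.1 * X sg + (1 - a sg.1) * X' sg) Y)
      (fun sg => a sg.1 * star X Y sg + (1 - a sg.1) * star X' Y sg).
Proof.
move=> ha [s h]; apply: star_le => h1 h2 d -> /=.
have /andP[a0 a1] := ha s.
rewrite mulrDl -!mulrA; apply: lerD; apply: ler_wpM2l; rewrite ?subr_ge0 //;
  exact: le_star.
Qed.

Lemma star_if_le (b : bexpr V) X X' Y :
  ele (star (fun sg => \1_(guard b) sg * X sg + \1_(~` guard b) sg * X' sg) Y)
      (fun sg => \1_(guard b) sg * star X Y sg
                 + \1_(~` guard b) sg * star X' Y sg).
Proof.
pose a (s : stack V) : R := (beval b s)%:R.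
have aE sg : \1_(guard b) sg = a sg.1 by rewrite indicE mem_setE.
have ha s : 0 <= a s <= 1 by rewrite /a; case: beval; rewrite ?lexx ler01.
have ifE Z Z' : (fun sg => \1_(guard b) sg * Z sg + \1_(~` guard b) sg * Z' sg)
    = (fun sg => a sg.1 * Z sg + (1 - a sg.1) * Z' sg).
  by apply/funext => sg; rewrite indic_guardC aE.
by rewrite !ifE; exact: star_choice_le.
Qed.

Lemma star_sup_le (I : Type) (F : I -> state V -> R) Y : inhabited I ->
  (forall i, E1 (F i)) -> E1 Y ->
  ele (star (fun sg => sup [set F i sg | i in [set: I]]) Y)
      (fun sg => sup [set star (F i) Y sg | i in [set: I]]).
Proof.
move=> [i0] hF hY [s h]; apply: star_le => h1 h2 d ->{h}.
set r := sup [set star _ _ _ | _ in _].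
have ub i : F i (s, h1) * Y (s, h2) <= r.
  apply: le_trans (le_star (F i) Y s d) _.
  apply: ub_le_sup; last by exists i.
  by exists 1 => _ [j _ <-]; case/andP: (star_E1 (hF j) hY (s, hunion h1 h2)).
have /andP[y0 _] := hY (s, h2); have /andP[f0 _] := hF i0 (s, h1).
(* Moving the factor [Y (s, h2)] out of the supremum means dividing by it. If it is 0, only [0 <= r]
   remains, which the index [i0] provides. *)
move: y0; rewrite le_eqVlt => /predU1P[y0|y_gt0].
  by move: (ub i0); rewrite -y0 !mulr0.
rewrite -ler_pdivlMr //; apply: ge_sup; first by exists (F i0 (s, h1)), i0.
by move=> _ [i _ <-]; rewrite ler_pdivlMr.
Qed.

Lemma ele_trans X Y Z : ele X Y -> ele Y Z -> ele X Z.
Proof. by move=> XY YZ sg; apply: le_trans (YZ sg). Qed.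

(** An address block fresh for the whole heap is fresh for the part without the frame, so the
    infimum on the right ranges over fewer addresses. *)
Lemma star_alloc_le X Y x (es : seq (expr V)) : E1 X -> E1 Y -> ~ Vars Y x ->
  ele (star (wlp (New x es) X) Y) (wlp (New x es) (star X Y)).
Proof.
move=> hX hY nx [s h]; apply: star_le => h1 h2 d ->{h}.
apply: le_inf01.
  by apply: mul_itv01; [exact: (wlp_E1 (New x es) hX)|exact: hY].
move=> _ [v [v0 vfresh] <-].
apply: le_trans (wand_mono _ (star_E1 (subst_E1 x (Cst v) hX) hY)
  (star_subst_le X (Cst v) nx) _).
apply: le_trans (star_wand_le _ (subst_E1 x (Cst v) hX) hY _).
apply: le_trans (le_star _ Y s d).
apply: ler_wpM2r; first by case/andP: (hY (s, h2)).
apply: inf01_lb.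
  by move=> _ [w _ <-]; case/andP:
    (wand_E1 (points_to (Cst w) es) (subst_E1 x (Cst w) hX) (s, h1)).
exists v => //; split=> // i /vfresh /=.
by rewrite dom_hunion in_fsetU negb_or => /andP[].
Qed.

(** Serves mutation directly and, with [phi] and [psi] equal, lookup at a fixed value. *)
Lemma star_store_le (phi psi : set (state V)) X Y : E1 X -> E1 Y ->
  ele (star (star \1_phi (wand psi X)) Y) (star \1_phi (wand psi (star X Y))).
Proof.
move=> hX hY; apply: ele_trans (star_assoc_le _ _ (indic_E1 _ phi)) _.
apply: star_mono; [exact: indic_E1| |by move=> ?|exact: star_wand_le].
by apply: star_E1; first exact: wand_E1.
Qed.

Lemma star_lookup_le X Y x (e : expr V) : E1 X -> E1 Y -> ~ Vars Y x ->
  ele (star (wlp (Lookup x e) X) Y) (wlp (Lookup x e) (star X Y)).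
Proof.
move=> hX hY nx.
pose F Z v := star \1_(points_to e [:: Cst v])
  (wand (points_to e [:: Cst v]) (subst Z x (Cst v))) : state V -> R.
have FE Z v : E1 Z -> E1 (F Z v).
  move=> hZ; apply: star_E1; first exact: indic_E1.
  exact/wand_E1/subst_E1.
have hXY := star_E1 hX hY.
apply: ele_trans (star_sup_le (F := F X) (inhabits 0) _ hY) _.
  by move=> v; exact: FE.
move=> sg; apply: ge_sup; first by exists (star (F X 0) Y sg), 0.
move=> _ [v _ <-]; apply: (@le_trans _ _ (F (star X Y) v sg)); last first.
  apply: ub_le_sup; last by exists v.
  by exists 1 => _ [w _ <-]; case/andP: (FE (star X Y) w hXY sg).
apply: ele_trans (star_store_le _ _ (subst_E1 x (Cst v) hX) hY) _ sg.
have hS := star_E1 (subst_E1 x (Cst v) hX) hY.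
apply: star_mono; [exact: indic_E1|exact: wand_E1|by move=> ?|].
by apply: wand_mono => //; exact: star_subst_le.
Qed.

Lemma frame_rule (c : cmd V) X Y : E1 X -> E1 Y ->
  (forall x, Mod c x -> ~ Vars Y x) ->
  ele (star (wlp c X) Y) (wlp c (star X Y)).
Proof.
move=> + hY.
elim: c X => [|x e|c1 IH1 c2 IH2|b c1 IH1 c2 IH2|b c IH|c1 IH1 p c2 IH2
  |x es|e e'|x e|e] X hX /= hM.
- by move=> sg.
- by apply: star_subst_le; exact: hM.
- have hX2 := wlp_E1 c2 hX; have hXY := star_E1 hX hY.
  apply: ele_trans (IH1 _ hX2 _) _; first by move=> x ?; apply: hM; left.
  apply: wlp_mono; [exact: star_E1|exact: wlp_E1|].
  by apply: IH2 => // x ?; apply: hM; right.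
- apply: ele_trans (star_if_le _ _ _ _) _ => sg.
  rewrite indic_guardC; apply: choice_mono; last exact: indic_E1.
    by apply: IH1 => // x ?; apply: hM; left.
  by apply: IH2 => // x ?; apply: hM; right.
- have [GE GF _] := wlp_while_gfp b c hX.
  set G := wlp (While b c) X in GE GF *.
  change (ele (star G Y) (wlp (While b c) (star X Y))).
  (* Coinduction: it suffices that [star G Y] is a post-fixed point of the loop functional for
     [star X Y]. To see this, [G] is unfolded once and the frame is distributed over the guard. *)
  apply: gfp_ub; first exact: star_E1.
  rewrite -[in X in ele X _]GF.
  under [in X in star X _]eq_fun do rewrite addrC.
  apply: ele_trans (star_if_le _ _ _ _) _ => sg.
  rewrite [leRHS]addrC indic_guardC.
  (* The induction hypothesis for the body is used with [G] as postexpectation; the exit branch is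
     already [star X Y] on both sides. *)
  by apply: choice_mono; [exact: IH|by move=> ?|exact: indic_E1].
- have hp := prob_itv R p.
  apply: ele_trans
    (star_choice_le (a := fun=> ratr (sval p)) _ _ _ (fun=> hp)) _ => sg.
  apply: choice_mono => //.
    by apply: IH1 => // x ?; apply: hM; left.
  by apply: IH2 => // x ?; apply: hM; right.
- by apply: star_alloc_le => //; exact: hM.
- exact: star_store_le.
- by apply: star_lookup_le => //; exact: hM.
- exact: star_assoc_le _ _ (indic_E1 _ _).
Qed.

End Frame.

Theorem theorem5p1 (R : realType) (V : eqType) (c : cmd V)
    (X Y : state V -> R) (hX : E1 X) (hY : E1 Y)
    (hMod : Mod c `&` Vars Y = set0) :
  ele (star (wlp c X) Y) (wlp c (star X Y)).
Proof.
by apply: frame_rule => // x xM xY; rewrite -[False]/(set0 x) -hMod.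
Qed.
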